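(* Let $d \ge 1$ and $s \ge 1$ be integers, and let $\mathbf{n}, \mathbf{r} \in \mathbb{Z}_{\ge 0}^d$ be integer vectors. Suppose that $n_i \ge s$ and $r_i \ge s$ for all $i \in [d]$. Define $\mathbf{s} \in \mathbb{Z}_{\ge 0}^d$ by $s_i = s$ for all $i \in [d]$. Then $$\mathrm{wsat}(K^{\mathbf{s}}_{\mathbf{n}}, K^{\mathbf{s}}_{\mathbf{r}}) = \prod_{i\in[d]} \binom{n_i}{s} - \tilde{q}(\mathbf{n}, s, \mathbf{r}),$$ where $$\tilde{q}(\mathbf{n}, s, \mathbf{r}) = \left|\left\{T \in \prod_{i \in [d]} \binom{[n_i]}{s}\ \middle|\ \exists \sigma \in S_d\ \forall i \in [d]\ \ T_i \in \binom{[n_i] \setminus [r_{\sigma(i)} - s]}{s}\right\}\right|.$$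
   Context: Notation: for an integer $n\ge 1$, $[n]=\{1,\dots,n\}$, and $[n]=\emptyset$ for $n\le 0$. For a finite set $A$ and an integer $k\ge 0$, $\binom{A}{k}$ is the set of all $k$-element subsets of $A$ (and $\binom{A}{k}=\emptyset$ for $k<0$). $S_d$ is the set of all permutations of $[d]$. A hypergraph $G$ has a finite vertex set $V(G)$ and an edge set $E(G)$ which is a set of subsets of $V(G)$ (not necessarily uniform). For $\mathbf{s},\mathbf{r}\in\mathbb{Z}_{\ge0}^d$, the hypergraph $K^{\mathbf{s}}_{\mathbf{r}}$ (tensor product of cliques) has vertex set $\bigcup_{i\in[d]}[r_i]\times\{i\}$, and its edges are exactly the vertex subsets $W$ with $|W\cap([r_i]\times\{i\})|=s_i$ for all $i\in[d]$. A copy of a hypergraph $H$ in a hypergraph $G$ is a subhypergraph of $G$ (a hypergraph $\widetilde H$ with $V(\widetilde H)\subseteq V(G)$, $E(\widetilde H)\subseteq E(G)$) isomorphic to $H$. Given hypergraphs $G$ and $H$, a spanning subhypergraph $F$ of $G$ (i.e. $V(F)=V(G)$, $E(F)\subseteq E(G)$) is weakly $H$-saturated in $G$ if there is an ordering $e_1,\dots,e_k$ of the edges in $E(G)\setminus E(F)$ such that, for each $i$, the edge $e_i$ belongs to a copy of $H$ in the hypergraph $F\cup\{e_1,\dots,e_i\}$. The weak saturation number $\mathrm{wsat}(G,H)$ is the minimum number of edges of such an $F$. *)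

(* Defs.v *)
From mathcomp Require Import all_boot all_order all_fingroup all_algebra.

Set Implicit Arguments.
Unset Strict Implicit.
Unset Printing Implicit Defensive.

(* The vertex set is the whole carrier type, so a spanning subhypergraph of G
   is given by a subset of [edges G]. *)
Record hypergraph := Hypergraph {
  vertex :> finType;
  edges : {set {set vertex}}
}.

Definition hiso (G H : hypergraph) : bool :=
  [exists f : {ffun G -> H},
     [&& injectiveb f, f @: [set: G] == [set: H]
       & [set f @: (e : {set G}) | e in edges G] == edges H]].

Definition is_subhypergraph (G : hypergraph)
    (V : {set G}) (E : {set {set G}}) : bool :=
  (E \subset edges G) && [forall e in E, e \subset V].

(* The hypergraph (V, E), for E a set of subsets of V; its edges are those of E
   seen as sets of elements of the subtype V. *)
Definition subhypergraph (G : hypergraph)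
    (V : {set G}) (E : {set {set G}}) : hypergraph :=
  @Hypergraph {x : G | x \in V} [set e : {set {x : G | x \in V}} | val @: e \in E].

Definition is_copy (H G : hypergraph) (V : {set G}) (E : {set {set G}}) : bool :=
  is_subhypergraph V E && hiso (subhypergraph V E) H.

Definition in_copy (H G : hypergraph) (e : {set G}) : bool :=
  [exists V : {set G}, [exists E : {set {set G}}, is_copy H V E && (e \in E)]].

(* The ordering e_1, ..., e_k of E(G) \ E(F) is the tuple t; the indices are
   shifted by one, so that [take i.+1 t] ends with [tnth t i]. *)
Definition weakly_saturated (G H : hypergraph) (F : {set {set G}}) : bool :=
  (F \subset edges G) &&
  [exists t : #|edges G :\: F|.-tuple {set G},
     perm_eq t (enum (edges G :\: F)) &&
     [forall i : 'I_#|edges G :\: F|,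
        @in_copy H (@Hypergraph G (F :|: [set e in take i.+1 t])) (tnth t i)]].

Definition wsat (G H : hypergraph) : nat :=
  #|[arg min_(F < edges G | weakly_saturated H F) #|F|]|.

Lemma weakly_saturated_edges (G H : hypergraph) :
  weakly_saturated H (edges G).
Proof.
rewrite /weakly_saturated subxx /=.
apply/existsP; exists (enum_tuple (edges G :\: edges G)).
rewrite perm_refl /=; apply/forallP => -[i lti].
by exfalso; move: lti; rewrite setDv cards0.
Qed.

Lemma wsatP (G H : hypergraph) :
  (exists2 F : {set {set G}}, weakly_saturated H F & #|F| = wsat G H) /\
  (forall F : {set {set G}}, weakly_saturated H F -> wsat G H <= #|F|).
Proof.
rewrite /wsat; case: arg_minnP => [|F wF minF].
  exact: weakly_saturated_edges.
by split; [exists F | move=> F' /minF].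
Qed.

(* [Tagged _ j] with tag i, for j : 'I_(r i), stands for the vertex (j + 1, i)
   of [r_i] x {i}. *)
Definition clique_vertex (d : nat) (r : 'I_d -> nat) : finType :=
  {i : 'I_d & 'I_(r i)}.

Definition clique_tensor (d : nat) (s r : 'I_d -> nat) : hypergraph :=
  @Hypergraph (clique_vertex r)
    [set W : {set clique_vertex r} |
       [forall i, #|W :&: [set x : clique_vertex r | tag x == i]| == s i]].

Definition ksubsets (T : finType) (A : {set T}) (k : nat) : {set {set T}} :=
  [set B : {set T} | B \subset A & #|B| == k].

(* Elements of 'I_n are numbered from 0, so [n] \ [m] is the set of j : 'I_n
   that do not satisfy j < m. *)
Definition above (n m : nat) : {set 'I_n} := ~: [set j : 'I_n | j < m].

Definition qtilde (d : nat) (n : 'I_d -> nat) (s : nat) (r : 'I_d -> nat) : nat :=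
  #|[set T : {dffun forall i : 'I_d, {set 'I_(n i)}} |
       [forall i, T i \in ksubsets [set: 'I_(n i)] s] &&
       [exists sigma : 'S_d,
          [forall i, T i \in ksubsets (above (n i) (r (sigma i) - s)) s]]]|.

(* Main.v *)
(** Let Q be the set of edges counted by qtilde. For the upper bound, take F to
    be the complement of Q and order Q by the sum of the positions of the
    vertices: if sigma witnesses T in Q, then adding to each T_i the first
    r_(sigma i) - s vertices of part i yields a copy of the small clique tensor,
    and T is the edge of largest sum in it.

    For the lower bound, let p_0, p_1, ... be the Newton basis of polynomials at
    the points 0, 1, 2, ..., and let M(W, S) be the product over the parts i of
    the minors [p_u(v)] with v in W_i and u in S_i. M is triangular with respect
    to the above sum. A copy has vertex sets R_i of sizes r_(sigma i), and the
    vectors supported on R_i and orthogonal to p_u for u < r_(sigma i) - s form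
    a space of dimension s all of whose Pluecker coordinates on R_i are nonzero.
    The product of these coordinates over i is a relation, supported exactly on
    the edges of the copy, between the rows of M restricted to the columns S
    outside Q. Hence, if F is weakly saturated, the rows of F span all the rows
    of this matrix, which has full column rank, so that F has at least as many
    elements as the complement of Q. *)

Require Import Defs.
From mathcomp Require Import all_boot all_order all_fingroup all_algebra.
From mathcomp Require Import zify.

Set Implicit Arguments.
Unset Strict Implicit.
Unset Printing Implicit Defensive.

Import GRing.Theory Num.Theory.

(** * Triangular matrices and percolation *)

(** The matrix with rows indexed by [B] and columns by [A] has more rows than columns, hence a
    nonzero vector in its left kernel. *)
Lemma underdetermined_system (K : fieldType) (X Y : finType) (A : {set X})
    (B : {set Y}) (L : X -> Y -> K) :
  #|A| < #|B| ->
  exists2 c : Y -> K, exists2 y, y \in B & c y != 0%R &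
    forall x, x \in A -> (\sum_(y in B) L x y * c y = 0)%R.
Proof.
move=> ltAB.
pose M := (\matrix_(i < #|B|, j < #|A|) L (enum_val j) (enum_val i))%R.
have kM : kermx M != 0%R.
  by rewrite kermx_eq0 /row_free neq_ltn (leq_ltn_trans (rank_leq_col M)).
pose v := nz_row (kermx M).
have v0 : v != 0%R by rewrite nz_row_eq0.
have vM : (v *m M = 0)%R by apply/sub_kermxP/nz_row_sub.
case/rV0Pn: v0 => i vi.
have yB : enum_val i \in B by apply: enum_valP.
exists (fun y => v 0%R (enum_rank_in yB y)).
  by exists (enum_val i); rewrite ?enum_valK_in.
move=> x xA; move/rowP/(_ (enum_rank_in xA x)): vM; rewrite !mxE => vMx.
rewrite -[RHS]vMx big_enum_val; apply: eq_bigr => j _.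
by rewrite mxE enum_valK_in enum_rankK_in // mulrC.
Qed.

(* If #|F| < #|S|, some nonzero combination g of the columns in S vanishes on F,
   hence on E by following the process t; but at a point of the support of the
   combination where h is minimal, g is nonzero by triangularity. *)
Lemma triangular_percolation (K : fieldType) (X : finType) (E F S : {set X})
    (M : X -> X -> K) (h : X -> nat) (t : seq X) :
  S \subset E -> {in S, forall x, M x x != 0%R} ->
  {in S &, forall x y, M x y != 0%R -> x = y \/ h y < h x} ->
  {in E, forall x, x \notin F -> x \in t} ->
  (forall i, i < size t -> exists z : X -> K,
    [/\ forall x, index x t = i -> z x != 0%R,
        {in E, forall x, z x != 0%R -> (x \in F) || (index x t <= i)} &
        {in S, forall y, \sum_(x in E) z x * M x y = 0}%R]) ->
  #|S| <= #|F|.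
Proof.
move=> /subsetP sSE Mxx Mxy tE tz; rewrite leqNgt; apply/negP => ltFS.
have [c [y0 y0S cy0] cF] := underdetermined_system M ltFS.
pose g x := (\sum_(y in S) M x y * c y)%R.
have gE i : forall x, x \in E -> (x \in F) || (index x t < i) -> g x = 0%R.
  elim: i => [|i IH] x xE; first by rewrite orbF => /cF.
  rewrite ltnS leq_eqVlt orbCA => /orP[/eqP xi|]; last exact: IH.
  case: (boolP (x \in F)) => [/cF//|xF].
  have lti : i < size t by rewrite -xi index_mem tE.
  case: (tz i lti) => z [zx zF zS].
  (* Pair the relation [z] with [g]: the total is zero because [z] is orthogonal to each column in
     [S], and every term other than that of [x] vanishes by induction. *)
  have : (\sum_(x' in E) z x' * g x' = 0)%R.
    under eq_bigr do rewrite mulr_sumr.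
    rewrite exchange_big big1 // => y /zS zy.
    under eq_bigr do rewrite mulrA.
    by rewrite -mulr_suml zy mul0r.
  rewrite (bigD1 x) //= big1 => [|x' /andP[x'E nx']].
    by rewrite addr0 => /eqP; rewrite mulf_eq0 (negPf (zx _ xi)) => /eqP.
  case: (eqVneq (z x') 0%R) => [->|/(zF _ x'E) x'F]; first by rewrite mul0r.
  rewrite IH ?mulr0 //; case/orP: x'F => [->//|].
  rewrite leq_eqVlt => /orP[/eqP x'i|->]; last by rewrite orbT.
  case/eqP: nx'; rewrite -(nth_index x (tE _ xE xF)) xi -x'i nth_index //.
  by rewrite -index_mem x'i.
have : (y0 \in S) && (c y0 != 0)%R by apply/andP.
case/(@arg_minnP _ y0 (fun y => (y \in S) && (c y != 0%R)) h) => y /andP[yS cy] miny.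
have /eqP : g y = 0%R.
  apply: (gE (size t).+1) => //; first exact: sSE.
  by rewrite ltnS index_size orbT.
rewrite /g (bigD1 y) //= big1 ?addr0 => [|y' /andP[y'S ny']].
  by rewrite mulf_eq0 (negPf cy) orbF (negPf (Mxx _ yS)).
case: (eqVneq (c y') 0%R) => [->|cy']; first by rewrite mulr0.
case: (eqVneq (M y y') 0%R) => [->|/(Mxy _ _ yS y'S)[yy'|]]; first by rewrite mul0r.
  by rewrite yy' eqxx in ny'.
by rewrite ltnNge miny // y'S.
Qed.

(** * Minors *)

Section Minors.
Variables (K : comNzRingType) (V : finType) (v0 : V) (k : nat).

Definition elem (W : {set V}) (a : 'I_k) : V := nth v0 (enum W) a.

Lemma elemP (W : {set V}) (a : 'I_k) : #|W| = k -> elem W a \in W.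
Proof. by move=> Wk; rewrite -mem_enum mem_nth // -cardE Wk. Qed.

Lemma elem_inj (W : {set V}) : #|W| = k -> injective (elem W).
Proof.
move=> Wk a b /eqP; rewrite nth_uniq ?enum_uniq -?cardE ?Wk //.
by move/eqP/val_inj.
Qed.

Lemma elem_onto (W : {set V}) : #|W| = k -> elem W @: [set: 'I_k] = W.
Proof.
move=> Wk; apply/eqP; rewrite eqEcard card_imset; last exact: elem_inj.
rewrite cardsT card_ord Wk leqnn andbT.
by apply/subsetP => _ /imsetP[a _ ->]; apply: elemP.
Qed.

Lemma mem_elem (W : {set V}) (v : V) :
  #|W| = k -> v \in W -> exists a, v = elem W a.
Proof.
by move=> Wk; rewrite -{1}(elem_onto Wk) => /imsetP[a _ ->]; exists a.
Qed.

Lemma big_elem (R : Type) (idx : R) (op : Monoid.com_law idx) (W : {set V})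
    (F : V -> R) : #|W| = k ->
  \big[op/idx]_(a < k) F (elem W a) = \big[op/idx]_(v in W) F v.
Proof.
move=> Wk; rewrite -[in RHS](elem_onto Wk) big_imset /=; last first.
  by move=> a b _ _; apply: elem_inj.
by apply: eq_bigl => a; rewrite inE.
Qed.

Lemma elem_perm (W : {set V}) (f : 'I_k -> V) :
  #|W| = k -> f @: [set: 'I_k] = W -> exists s : 'S_k, f =1 elem W \o s.
Proof.
move=> Wk fW.
have lt_idx a : index (f a) (enum W) < k.
  by rewrite -Wk cardE index_mem mem_enum -fW imset_f.
pose g a : 'I_k := Ordinal (lt_idx a).
have gE a : f a = elem W (g a).
  by rewrite /elem nth_index // mem_enum -fW imset_f.
have f_inj : injective f.
  have /imset_injP injf : #|f @: [set: 'I_k]| == #|[set: 'I_k]|.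
    by rewrite fW Wk cardsT card_ord.
  by move=> a b; apply: injf; rewrite inE.
have g_inj : injective g by move=> a b /(congr1 (elem W)); rewrite -!gE => /f_inj.
by exists (perm g_inj) => a; rewrite /= permE -gE.
Qed.

Definition minor (P : V -> V -> K) (W S : {set V}) : K :=
  (\det (\matrix_(a < k, b < k) P (elem W a) (elem S b)))%R.

(* This is k! when #|W| = k, but only its positivity is needed. *)
Definition enum_count (W : {set V}) : nat :=
  #|[set f : {ffun 'I_k -> V} | f @: [set: 'I_k] == W]|.

Lemma enum_count_gt0 (W : {set V}) : #|W| = k -> 0 < enum_count W.
Proof.
move=> Wk; apply/card_gt0P; exists (finfun (elem W)).
rewrite inE -[X in _ == X](elem_onto Wk); apply/eqP/eq_imset => a.
by rewrite ffunE.
Qed.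

(* A zero column of the product X P kills its determinant, which the
   Cauchy-Binet formula expands into minors. *)
Lemma cauchy_binet_eq0 (X : 'I_k -> V -> K) (P : V -> 'I_k -> K) (b0 : 'I_k) :
  (forall a, \sum_v X a v * P v b0 = 0)%R ->
  (\sum_(W : {set V} | #|W| == k)
     (enum_count W)%:R * \det (\matrix_(b < k, a < k) X a (elem W b))
       * \det (\matrix_(a < k, b < k) P (elem W a) b) = 0)%R.
Proof.
move=> XP0.
pose G (f : 'I_k -> V) := (\det (\matrix_(b < k, a < k) X a (f b))
       * \det (\matrix_(a < k, b < k) P (f a) b))%R.
have sumG0 : (\sum_(f : {ffun 'I_k -> V}) G f = 0)%R.
  transitivity (\sum_(f : {ffun 'I_k -> V}) \sum_(p : 'S_k) \sum_(q : 'S_k)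
     ((-1) ^+ p * (-1) ^+ q * \prod_b (X (p b) (f b) * P (f b) (q b))))%R.
    apply: eq_bigr => f _; rewrite /G mulr_suml; apply: eq_bigr => p _.
    rewrite mulr_sumr; apply: eq_bigr => q _.
    rewrite big_split mulrACA; congr (_ * (_ * _))%R;
      by apply: eq_bigr => i _; rewrite mxE.
  (* For fixed [p] and [q] the sum over [f] is a product over [b] of sums over [v]; the factor with
     [q b = b0] is zero. *)
  rewrite exchange_big big1 // => p _; rewrite exchange_big big1 // => q _.
  rewrite -mulr_sumr -(bigA_distr_bigA (fun b v => X (p b) v * P v (q b))%R).
  by rewrite (bigD1 ((q^-1)%g b0)) //= permKV XP0 mul0r mulr0.
(* Group the functions by image. Those with image [W] of size [k] enumerate [W], and the sign of the
   reordering occurs twice in [G]; the others are not injective and give determinants with two equal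
   rows. *)
rewrite -[RHS]sumG0 (partition_big (fun f : {ffun _} => f @: [set: 'I_k]) xpredT) //=.
rewrite [in RHS](bigID (fun W : {set V} => #|W| == k)) /=.
rewrite [X in (_ = _ + X)%R]big1 ?addr0.
  apply: eq_bigr => W /eqP Wk.
  transitivity (\sum_(f : {ffun 'I_k -> V} | f @: [set: 'I_k] == W)
                  G (elem W))%R.
    rewrite sumr_const -[RHS]mulr_natl -mulrA; congr (_%:R * _)%R.
    by apply: eq_card => f; rewrite inE.
  apply: eq_bigr => f /eqP fW; have [s fs] := elem_perm Wk fW.
  have rowE (Y : V -> 'I_k -> K) : (\det (\matrix_(a < k, b < k) Y (f a) b)
      = (-1) ^+ s * \det (\matrix_(a < k, b < k) Y (elem W a) b))%R.
    rewrite -det_perm -det_mulmx -row_permE; congr (\det _)%R.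
    by apply/matrixP => a b; rewrite !mxE fs.
  rewrite /G (rowE (fun v a => X a v)) (rowE P) mulrACA -signr_addb addbb.
  by rewrite mul1r.
move=> W Wk; apply: big1 => f /eqP fW.
have : ~~ injectiveb f.
  by apply: contra Wk => /injectiveP/card_imset fk; rewrite -fW fk cardsT card_ord.
case/injectivePn => a [b nab fab]; rewrite /G.
rewrite (determinant_alternate nab) ?mul0r // => c; by rewrite !mxE fab.
Qed.

End Minors.

Lemma det_neq0_perm (K : comNzRingType) (k : nat) (A : 'M[K]_k) :
  (\det A)%R != 0%R -> exists s : 'S_k, forall a, A a (s a) != 0%R.
Proof.
move=> dA.
case: (pickP (fun s : 'S_k => [forall a, A a (s a) != 0%R])) => [s /forallP|nA].
  by exists s.
case/eqP: dA; apply: big1 => s _; move/negbT: (nA s); rewrite negb_forall.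
by case/existsP => a; rewrite negbK => /eqP Aa; rewrite (bigD1 a) //= Aa mul0r mulr0.
Qed.

(** * Minors of a triangular matrix *)

Section TriangularMinors.
Variables (K : idomainType) (V : finType) (v0 : V) (k : nat).
Variables (P : V -> V -> K) (h : V -> nat) (T : eqType) (tg : V -> T).
Hypothesis Pvv : forall v, P v v != 0%R.
Hypothesis Pvu : forall v u, P v u != 0%R -> tg v = tg u /\ (v = u \/ h u < h v).

Let M := @minor K V v0 k P.

(** A nonzero entry bounds the value of [h] at the vertex of [S] by its value at the matched vertex
    of [W], strictly unless the two coincide; sum over the matching. *)
Lemma perm_triangular (W S : {set V}) (s : 'S_k) : #|W| = k -> #|S| = k ->
  (forall a, P (elem v0 W a) (elem v0 S (s a)) != 0%R) ->
  (forall a, elem v0 W a = elem v0 S (s a)) \/ \sum_(v in S) h v < \sum_(v in W) h v.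
Proof.
move=> Wk Sk Ps.
have [/forallP eqWS|] := boolP [forall a, elem v0 W a == elem v0 S (s a)].
  by left => a; apply/eqP.
rewrite negb_forall => /existsP[a na]; right.
rewrite -(big_elem v0 addn h Wk) -(big_elem v0 addn h Sk).
rewrite (reindex_inj (@perm_inj _ s)) /=.
rewrite (bigD1 a) //= [in X in _ < X](bigD1 a) //=.
rewrite -addSn leq_add //.
  by case: (Pvu (Ps a)) => _ [eqa|//]; rewrite eqa eqxx in na.
apply: leq_sum => b _; case: (Pvu (Ps b)) => _ [->//|]; exact: ltnW.
Qed.

Lemma minor_triangular (W S : {set V}) : #|W| = k -> #|S| = k ->
  M W S != 0%R -> W = S \/ \sum_(v in S) h v < \sum_(v in W) h v.
Proof.
move=> Wk Sk /det_neq0_perm[s Ps].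
have [|eqWS|->] := @perm_triangular W S s Wk Sk; [|left|by right].
  by move=> a; move: (Ps a); rewrite mxE.
apply/eqP; rewrite eqEcard Wk Sk leqnn andbT; apply/subsetP => v.
by case/(mem_elem v0 Wk) => a ->; rewrite eqWS elemP.
Qed.

(** A nonzero term of the determinant matches each vertex of [W] to a vertex of [S] with the same
    tag. *)
Lemma minor_tag (W S : {set V}) (i : T) : #|W| = k -> #|S| = k ->
  M W S != 0%R ->
  #|W :&: [set v | tg v == i]| = #|S :&: [set v | tg v == i]|.
Proof.
move=> Wk Sk /det_neq0_perm[s Ps].
have cardE' (U : {set V}) : #|U| = k ->
    #|U :&: [set v | tg v == i]| = \sum_(a < k) (tg (elem v0 U a) == i).
  move=> Uk; rewrite (big_elem v0 addn (fun v => (tg v == i) : nat) Uk) -sum1_card.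
  rewrite big_mkcond [RHS]big_mkcond; apply: eq_bigr => v _.
  by rewrite !inE; case: (v \in U); case: eqP.
rewrite (cardE' W Wk) (cardE' S Sk) [RHS](reindex_inj (@perm_inj _ s)).
apply: eq_bigr => a _; move: (Ps a); rewrite mxE => /Pvu[-> //].
Qed.

(** Only the identity contributes: another permutation with a nonzero term would make the sum of [h]
    over [W] smaller than itself. *)
Lemma minor_diag (W : {set V}) : #|W| = k -> M W W != 0%R.
Proof.
move=> Wk; rewrite /M /minor /determinant (bigD1 (1%g : 'S_k)) //=.
rewrite [X in (_ + X)%R]big1 => [|s n1].
  rewrite odd_perm1 expr0 mul1r addr0; apply/prodf_neq0 => a _.
  by rewrite mxE perm1.
case: (pickP (fun a => P (elem v0 W a) (elem v0 W (s a)) == 0%R)) => [a /eqP Pa|Ps].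
  by rewrite (bigD1 a) //= mxE Pa mul0r mulr0.
have [|eqs|] := @perm_triangular W W s Wk Wk; last by rewrite ltnn.
  by move=> a; rewrite Ps.
case/eqP: n1; apply/permP => a; rewrite perm1; apply/esym.
exact: elem_inj (eqs a).
Qed.

End TriangularMinors.

(** * Relations supported on boxes *)

(** Up to a scalar these are the inverses of the products of [x v - x y] over the other points [y]
    of [R], as in Lagrange interpolation. They are obtained from a kernel: [#|R| - 1] monomials
    against [#|R|] points. *)
Lemma dual_weights (K : fieldType) (T : finType) (x : T -> K) (R : {set T}) :
  R != set0 -> {in R &, injective x} ->
  exists2 b : T -> K, {in R, forall v, b v != 0%R} &
    forall q : {poly K}, size q < #|R| -> (\sum_(v in R) b v * q.[x v] = 0)%R.
Proof.
rewrite -card_gt0 => R0 x_inj.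
have [|c [w wR cw] c0] := @underdetermined_system K _ _ [set: 'I_#|R|.-1] R
   (fun i v => x v ^+ i)%R; first by rewrite cardsT card_ord prednK.
have cq (q : {poly K}) : size q < #|R| -> (\sum_(v in R) c v * q.[x v] = 0)%R.
  move=> sq; have {}sq : size q <= #|R|.-1 by rewrite -ltnS prednK.
  under eq_bigr do rewrite (horner_coef_wide _ sq) mulr_sumr.
  rewrite exchange_big big1 // => i _.
  under eq_bigr do rewrite mulrCA [(c _ * _)%R]mulrC.
  by rewrite -mulr_sumr c0 ?mulr0 ?inE.
exists c => // v vR; apply/negP => /eqP cv.
have nvw : v != w by apply: contra cw => /eqP <-; rewrite cv.
(* If [c v] is zero, this polynomial, which vanishes on [R] outside [v] and [w], isolates the
   nonzero term at [w]. *)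
pose q := (\prod_(y in R :\ w :\ v) ('X - (x y)%:P))%R.
have sq : size q < #|R|.
  rewrite /q -big_enum size_prod_XsubC -cardE (cardsD1 w R) wR (cardsD1 v (R :\ w)).
  by rewrite !inE nvw vR.
have := cq q sq; rewrite (bigD1 w) //= big1 ?addr0 => [|y /andP[yR nyw]].
  apply/eqP; rewrite mulf_neq0 // horner_prod; apply/prodf_neq0 => y.
  rewrite !inE hornerXsubC subr_eq0 => /and3P[_ nyw yR].
  by apply: contra nyw => /eqP /x_inj ->.
have [->|nyv] := eqVneq y v; first by rewrite cv mul0r.
rewrite horner_prod (bigD1 y) ?inE ?nyv ?nyw //=.
by rewrite hornerXsubC subrr mul0r mulr0.
Qed.

(** The falling factorial [X (X - 1) ... (X - u + 1)]. *)
Definition newton (u : nat) : {poly rat} := (\prod_(l < u) ('X - l%:R%:P))%R.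

Lemma size_newton (u : nat) : size (newton u) = u.+1.
Proof. by rewrite size_prod_XsubC /index_enum -enumT size_enum_ord. Qed.

Lemma newton_eq0 (u v : nat) : ((newton u).[v%:R] == 0)%R = (v < u).
Proof.
rewrite horner_prod; apply/prodf_eq0/idP => [[l _]|ltvu].
  by rewrite hornerXsubC subr_eq0 eqr_nat => /eqP ->.
by exists (Ordinal ltvu); rewrite ?hornerXsubC ?subrr.
Qed.

(** * The Newton matrix on vertices and its minors on edges *)

Section Weights.
Variables (d s : nat) (n : 'I_d -> nat).

Notation V := (clique_vertex n).

Definition part (i : 'I_d) : {set V} := [set v | tag v == i].

Definition pos (v : V) : nat := tagged v.

Definition height (W : {set V}) : nat := \sum_(v in W) pos v.

Definition cedges : {set {set V}} := edges (clique_tensor (fun _ : 'I_d => s) n).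

Lemma cedgesP (W : {set V}) :
  reflect (forall i, #|W :&: part i| = s) (W \in cedges).
Proof. by rewrite inE; apply: (iffP forallP) => H i; apply/eqP; have := H i. Qed.

Lemma pos_inj (v w : V) : tag v = tag w -> pos v = pos w -> v = w.
Proof.
case: v w => i j [i' j'] /= ii'; case: _ / ii' j' => j'.
by rewrite /pos /= => /val_inj ->.
Qed.

Lemma big_parts (R : Type) (idx : R) (op : Monoid.com_law idx) (W : {set V})
    (F : V -> R) :
  \big[op/idx]_(v in W) F v =
  \big[op/idx]_(i < d) \big[op/idx]_(v in W :&: part i) F v.
Proof.
rewrite (partition_big (fun v : V => tag v) xpredT) //; apply: eq_bigr => i _.
by apply: eq_bigl => v; rewrite !inE.
Qed.

Lemma card_parts (W : {set V}) : #|W| = \sum_(i < d) #|W :&: part i|.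
Proof. by rewrite -sum1_card big_parts; apply: eq_bigr => i _; rewrite sum1_card. Qed.

(** Block diagonal with one block per part, so that on edges a single determinant gives, up to sign,
    the product of the minors over the parts. *)
Definition tensor_newton (v u : V) : rat :=
  (if tag v == tag u then (newton (pos u)).[(pos v)%:R] else 0)%R.

Lemma tensor_newton_diag (v : V) : (tensor_newton v v != 0)%R.
Proof. by rewrite /tensor_newton eqxx newton_eq0 ltnn. Qed.

Lemma tensor_newton_triangular (v u : V) : (tensor_newton v u != 0)%R ->
  tag v = tag u /\ (v = u \/ pos u < pos v).
Proof.
rewrite /tensor_newton; have [vu|_] := eqVneq (tag v); last by rewrite eqxx.
rewrite newton_eq0 -leqNgt leq_eqVlt => /orP[/eqP uv|]; last by split => //; right.
by split => //; left; apply: pos_inj.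
Qed.

(** This is [d * s], written as a cardinal so that [enum_val] reads an index below [k] as a pair of
    a part and an exponent. *)
Let k := #|{: 'I_d * 'I_s}|.

Lemma cedges_card (W : {set V}) : W \in cedges -> #|W| = k.
Proof.
move=> /cedgesP Wi; rewrite card_parts; under eq_bigr do rewrite Wi.
by rewrite sum_nat_const /k card_prod !card_ord.
Qed.

Variable v0 : V.

Definition edge_minor : {set V} -> {set V} -> rat := @minor _ V v0 k tensor_newton.

(** Restricts the Cauchy-Binet sum over all sets of [k] vertices to the edges. *)
Lemma edge_minor_cedges (W S : {set V}) : S \in cedges -> #|W| = k ->
  (edge_minor W S != 0)%R -> W \in cedges.
Proof.
move=> SE Wk WS; apply/cedgesP => i; have /cedgesP/(_ i) <- := SE.
exact: (@minor_tag _ V v0 k _ pos _ (fun v => tag v) tensor_newton_triangular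
          W S i Wk (cedges_card SE) WS).
Qed.

Lemma edge_minor_diag (W : {set V}) : W \in cedges -> edge_minor W W != 0%R.
Proof.
move=> /cedges_card.
exact: (@minor_diag _ V v0 k _ pos _ (fun v => tag v) tensor_newton_diag
          tensor_newton_triangular).
Qed.

Lemma edge_minor_triangular (W S : {set V}) : W \in cedges -> S \in cedges ->
  edge_minor W S != 0%R -> W = S \/ height S < height W.
Proof.
move=> /cedges_card Wk /cedges_card Sk.
exact: (@minor_triangular _ V v0 k _ pos _ (fun v => tag v)
          tensor_newton_triangular).
Qed.

(* z is the vector of maximal minors of the matrix X whose rows span, part by
   part, the vectors on R :&: part i orthogonal to all polynomials of degree
   less than #|R :&: part i| - s: they are v |-> b_v v^e for e < s, with b the
   dual weights. *)
Lemma box_relation (R : {set V}) : 0 < s -> (forall i, s <= #|R :&: part i|) ->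
  exists z : {set V} -> rat,
  [/\ forall W, W \in cedges -> W \subset R -> z W != 0%R,
      forall W, W \in cedges -> z W != 0%R -> W \subset R &
      forall S u, S \in cedges -> u \in S -> pos u + s < #|R :&: part (tag u)| ->
        (\sum_(W in cedges) z W * edge_minor W S = 0)%R].
Proof.
move=> s0 sR.
pose x v : rat := ((pos v)%:R)%R.
have x_inj i : {in part i &, injective x}.
  move=> v w; rewrite !inE => /eqP vi /eqP wi /eqP; rewrite eqr_nat => /eqP.
  by apply: pos_inj; rewrite vi wi.
have /fin_all_exists2[b bn0 bq] i : exists2 b : V -> rat,
    {in R :&: part i, forall v, b v != 0%R} &
    forall q : {poly rat}, size q < #|R :&: part i| ->
       (\sum_(v in R :&: part i) b v * q.[x v] = 0)%R.
  apply: dual_weights; first by rewrite -card_gt0 (leq_trans s0).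
  by move=> v w /setIP[_ vi] /setIP[_ wi]; apply: (x_inj i).
pose X (a : 'I_k) v : rat := (let ie := enum_val a in
  if v \in R :&: part ie.1 then b ie.1 v * x v ^+ ie.2 else 0)%R.
pose D W := (\det (\matrix_(c < k, a < k) X a (elem v0 W c)))%R.
(* The factor [enum_count] is the multiplicity in [cauchy_binet_eq0]. *)
pose z W : rat := ((enum_count k W)%:R * D W)%R.
exists z; split.
- move=> W WE sWR; rewrite /z mulf_neq0 //.
    by rewrite pnatr_eq0 -lt0n (enum_count_gt0 v0) ?cedges_card.
  (* If [D W] vanishes, a nonzero combination [c] of the rows of [X] vanishes on [W]. In part [i] it
     is [b i v] times a polynomial in [x v] with at most [s] coefficients, whose roots include the
     [s] vertices of [W] there; so every coefficient is zero. *)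
  rewrite /D -det_tr; apply/negP => /det0P[c cn0 cX].
  have cv v : v \in W -> (\sum_(a < k) c 0 a * X a v = 0)%R.
    case/(mem_elem v0 (cedges_card WE)) => e ->.
    move/rowP/(_ e): cX; rewrite !mxE => cXe; rewrite -[RHS]cXe.
    by apply: eq_bigr => a _; rewrite !mxE.
  have c0 (i : 'I_d) :
      (\poly_(e < s) (if insub e is Some e' then c 0 (enum_rank (i, e')) else 0)
         = 0 :> {poly rat})%R.
    set q := (\poly_(_ < _) _)%R; apply/eqP/negP => qn0.
    have : size [seq x v | v <- enum (W :&: part i)] < size q.
      apply: max_poly_roots; first exact/negP.
        apply/allP => _ /mapP[v + ->]; rewrite mem_enum => vWi.
        have vRi : v \in R :&: part i by apply: (subsetP (setSI _ sWR)).
        have := cv v; case/setIP: (vWi) => -> vi /(_ isT).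
        rewrite (reindex (enum_rank : 'I_d * 'I_s -> 'I_k)) /=; last first.
          by exists enum_val => ? _; rewrite ?enum_rankK ?enum_valK.
        have -> : (\sum_(ie : 'I_d * 'I_s) c 0 (enum_rank ie) * X (enum_rank ie) v
            = \sum_i \sum_e c 0 (enum_rank (i, e)) * X (enum_rank (i, e)) v)%R.
          by rewrite pair_bigA /=; apply: eq_bigr => -[].
        rewrite (bigD1 i) //= [X in (_ + X)%R]big1 ?addr0 => [|j nji].
          move=> cX0; rewrite /root -(mulrI_eq0 _ (mulfI (bn0 i v vRi))).
          rewrite -[X in _ == X]cX0 horner_poly mulr_sumr; apply/eqP/eq_bigr => e _.
          rewrite /X enum_rankK /= vRi valK mulrCA; congr (_ * _)%R.
        rewrite big1 // => e _; rewrite /X enum_rankK /= inE.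
        by move: vi; rewrite !inE => /eqP ->; rewrite eq_sym (negPf nji) andbF mulr0.
      rewrite map_inj_in_uniq ?enum_uniq // => v w; rewrite !mem_enum.
      by move=> /setIP[_ vi] /setIP[_ wi]; apply: (x_inj i).
    rewrite size_map -cardE; have /cedgesP/(_ i) -> := WE.
    by rewrite ltnNge size_poly.
  case/negP: cn0; apply/eqP/rowP => a; rewrite mxE -(enum_valK a).
  case: (enum_val a) => i e; have /polyP/(_ e) := c0 i.
  by rewrite coef_poly ltn_ord coef0 valK.
- move=> W WE zW; apply/negPn/negP => /subsetPn[v vW vR].
  case/eqP: zW; rewrite /z; apply/eqP; rewrite mulf_eq0; apply/orP; right.
  have [e ev] := mem_elem v0 (cedges_card WE) vW.
  rewrite /D (expand_det_row _ e) big1 // => a _.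
  by rewrite mxE /X -ev inE (negPf vR) mul0r.
move=> S u SE uS ltu.
have [e0 ue] := mem_elem v0 (cedges_card SE) uS.
have := @cauchy_binet_eq0 _ V v0 k X (fun v e => tensor_newton v (elem v0 S e)) e0.
move=> H; rewrite -[RHS]H; last first.
  move=> a; rewrite -ue /X; case: (enum_val a) => i e /=.
  case: (eqVneq (tag u) i) => [ui|nui]; last first.
    apply: big1 => v _; rewrite /tensor_newton !inE.
    case: (eqVneq (tag v) i) => [->|_]; rewrite ?andbF ?mul0r //.
    by rewrite eq_sym (negPf nui) mulr0.
  (* In the part of [u], the column pairs the dual weights with a polynomial of degree at most
     [pos u + s - 1], which they annihilate by the bound on [u]. *)
  rewrite -[RHS](bq i ('X^e * newton (pos u))%R); last first.
    rewrite mulrC size_mulXn -?size_poly_gt0 size_newton //.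
    by rewrite -ui; apply: leq_trans ltu; have := ltn_ord e; lia.
  rewrite [RHS]big_mkcond; apply: eq_bigr => v _.
  case: ifP => [|_]; rewrite ?mul0r // !inE => /andP[_ /eqP vi].
  by rewrite /tensor_newton vi ui eqxx hornerM hornerXn mulrA.
rewrite big_mkcond [RHS]big_mkcond; apply: eq_bigr => W _.
case: ifP => [WE|/negbT nWE]; first by rewrite cedges_card ?eqxx.
case: eqP => // Wk; apply/esym/eqP; rewrite mulf_eq0; apply/orP; right.
by apply/negPn; apply: contra nWE => WS; apply: edge_minor_cedges SE Wk WS.
Qed.

End Weights.

(** * Copies of clique tensors *)

(** Trades isomorphisms with hypergraphs on subtypes for injections [g]: from a copy, invert the
    isomorphism and include; from [g], take its range together with the images of the edges. *)
Lemma in_copyP (H G : hypergraph) (e : {set G}) :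
  in_copy H e <-> exists g : H -> G, [/\ injective g,
     forall w, w \in edges H -> g @: w \in edges G &
     exists2 w, w \in edges H & e = g @: w].
Proof.
split.
  case/existsP => U /existsP[E] /andP[/andP[/andP[/subsetP sE /forall_inP EU]]].
  case/existsP => f /and3P[/injectiveP f_inj /eqP fT /eqP fE] eE.
  have /fin_all_exists[g' g'K] (y : H) : exists x, f x = y.
    by have := in_setT y; rewrite -fT => /imsetP[x _ ->]; exists x.
  have fK x : g' (f x) = x by apply: f_inj; rewrite g'K.
  have imK (A : {set {x : G | x \in U}}) : (fun y => val (g' y)) @: (f @: A) = val @: A.
    by rewrite -imset_comp; apply: eq_imset => x /=; rewrite fK.
  exists (fun y => val (g' y)); split.
  - by move=> x y /val_inj /(congr1 f); rewrite !g'K.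
  - move=> w; rewrite -fE => /imsetP[A AE ->].
    by rewrite imK; apply: sE; rewrite inE in AE.
  pose A : {set {x : G | x \in U}} := val @^-1: e.
  have eA : e = val @: A.
    apply/setP => x; apply/idP/imsetP => [xe|[y + ->]]; last by rewrite inE.
    have xU : x \in U by apply: (subsetP (EU e eE)).
    by exists (Sub x xU); rewrite ?inE.
  exists (f @: A); last by rewrite imK.
  by rewrite -fE; apply: imset_f; rewrite inE -eA.
case=> g [g_inj gE [w wH ew]].
apply/existsP; exists (g @: setT).
apply/existsP; exists [set g @: (w : {set H}) | w in edges H].
apply/andP; split; last by rewrite ew; apply: imset_f.
apply/andP; split.
  apply/andP; split; first by apply/subsetP => _ /imsetP[w' wH' ->]; apply: gE.
  by apply/forall_inP => _ /imsetP[w' wH' ->]; apply: imsetS; apply: subsetT.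
have /fin_all_exists[f fP] (x : {x : G | x \in g @: setT}) : exists y, g y = val x.
  by case: x => x /= /imsetP[y _ ->]; exists y.
have gU y : g y \in g @: setT by apply: imset_f.
have fg y : f (Sub (g y) (gU y)) = y by apply: g_inj; rewrite fP.
have gfE (A : {set {x : G | x \in g @: setT}}) : g @: (f @: A) = val @: A.
  by rewrite -imset_comp; apply: eq_imset => x /=; rewrite fP.
apply/existsP; exists (finfun f).
have ffE (A : {set {x : G | x \in g @: setT}}) : finfun f @: A = f @: A.
  by apply: eq_imset => x; rewrite ffunE.
apply/and3P; split.
- by apply/injectiveP => x y; rewrite !ffunE => /(congr1 g); rewrite !fP => /val_inj.
- rewrite ffE; apply/eqP/setP => y; rewrite inE.
  by apply/imsetP; exists (Sub (g y) (gU y)).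
apply/eqP/setP => w'; apply/imsetP/idP => [[A] | wH'].
  rewrite inE => /imsetP[w1 w1H]; rewrite -gfE => /(imset_inj g_inj) fA ->.
  by rewrite ffE fA.
have wE : w' = f @: [set x | f x \in w'].
  apply/setP => y; apply/idP/imsetP => [yw|[x + ->]]; last by rewrite inE.
  by exists (Sub (g y) (gU y)); rewrite ?inE fg.
exists [set x | f x \in w']; last by rewrite ffE.
by rewrite inE -gfE -wE; apply: imset_f.
Qed.

(** The complements of [A] and of its image have the same size and are matched in the order of
    enumeration. *)
Lemma perm_extending (T : finType) (f : T -> T) (A : {set T}) :
  {in A &, injective f} -> exists p : {perm T}, {in A, p =1 f}.
Proof.
move=> f_inj.
pose h x := if x \in A then f x else nth x (enum (~: (f @: A))) (index x (enum (~: A))).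
have szE : size (enum (~: A)) = size (enum (~: (f @: A))).
  by rewrite -!cardE (cardsCs (~: A)) (cardsCs (~: (f @: A))) !setCK card_in_imset.
have lt_idx x : x \notin A -> index x (enum (~: A)) < size (enum (~: (f @: A))).
  by move=> xA; rewrite -szE index_mem mem_enum inE.
have hC x : x \notin A -> h x \in ~: (f @: A).
  by move=> xA; rewrite /h (negPf xA) -mem_enum mem_nth // lt_idx.
have h_inj : injective h.
  move=> x y; have [xA|xA] := boolP (x \in A); have [yA|yA] := boolP (y \in A).
  - by rewrite /h xA yA => /f_inj ->.
  - by move=> hxy; have := hC y yA; rewrite -hxy /h xA inE imset_f.
  - by move=> hxy; have := hC x xA; rewrite hxy /h yA inE imset_f.
  rewrite /h (negPf xA) (negPf yA) (set_nth_default x _ (lt_idx y yA)) => /eqP.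
  rewrite nth_uniq ?enum_uniq ?lt_idx // => /eqP xy.
  rewrite -(nth_index x (_ : x \in enum (~: A))) ?mem_enum ?inE // xy.
  by rewrite nth_index ?mem_enum ?inE.
by exists (perm h_inj) => x xA; rewrite permE /h xA.
Qed.

Lemma set_between (T : finType) (A B : {set T}) (m : nat) :
  A \subset B -> #|A| <= m <= #|B| ->
  exists C : {set T}, [/\ A \subset C, C \subset B & #|C| = m].
Proof.
move=> sAB; elim: m => [|m IH] /andP[leA leB].
  by exists A; split => //; apply/eqP; rewrite -leqn0.
move: leA; rewrite leq_eqVlt => /orP[/eqP Am|ltA]; first by exists A.
have [|C [sAC sCB Cm]] := IH; first by rewrite -ltnS ltA ltnW.
have : 0 < #|B :\: C| by rewrite cardsDS // subn_gt0 Cm.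
case/card_gt0P => x /setDP[xB xC]; exists (x |: C); split.
- by apply: subset_trans sAC _; apply: subsetUr.
- by rewrite subUset sub1set xB.
by rewrite cardsU1 xC Cm.
Qed.

(** * Edges, boxes and heights in clique tensors *)

Section Cliques.
Variables (d s : nat).

Lemma card_part (n : 'I_d -> nat) (i : 'I_d) : #|part n i| = n i.
Proof.
have -> : part n i = [set Tagged (fun i => 'I_(n i)) j | j : 'I_(n i)].
  apply/setP => v; rewrite !inE; apply/eqP/imsetP => [<-|[j _ ->]] //.
  by exists (tagged v) => //; case: v.
rewrite card_imset ?card_ord //.
by move=> x y /eqP; rewrite eq_Tagged => /eqP.
Qed.

Lemma cedge_between (n : 'I_d -> nat) (A B : {set clique_vertex n}) :
  A \subset B -> (forall i, #|A :&: part n i| <= s <= #|B :&: part n i|) ->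
  exists W, [/\ W \in cedges s n, A \subset W & W \subset B].
Proof.
move=> sAB AB.
have /fin_all_exists[C CP] i := set_between (setSI (part n i) sAB) (AB i).
exists [set v | v \in C (tag v)]; split.
- apply/cedgesP => i; have [_ sCB <-] := CP i; apply: eq_card => v.
  rewrite !inE; apply/andP/idP => [[+ /eqP <- //]|vC].
  have := subsetP sCB v vC; rewrite !inE => /andP[_ /eqP vi].
  by rewrite vi eqxx vC.
- apply/subsetP => v vA; have [/subsetP sAC _ _] := CP (tag v).
  by rewrite inE; apply: sAC; rewrite !inE vA eqxx.
apply/subsetP => v; rewrite inE; have [_ /subsetP sCB _] := CP (tag v).
by move=> /sCB /setIP[].
Qed.

Lemma cedge_containing (n : 'I_d -> nat) (v : clique_vertex n) :
  0 < s -> (forall i, s <= n i) -> exists2 W, W \in cedges s n & v \in W.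
Proof.
move=> s0 sn; have [||W [WE]] := @cedge_between n [set v] setT.
- exact: subsetT.
- move=> i; rewrite setTI card_part sn andbT (leq_trans _ s0) //.
  by rewrite -(cards1 v) subset_leq_card // subsetIl.
by rewrite sub1set; exists W.
Qed.

Lemma card_imset_part (n r : 'I_d -> nat) (g : clique_vertex r -> clique_vertex n)
    (U : {set clique_vertex r}) (j : 'I_d) : injective g ->
  #|g @: U :&: part n j| = #|[set v in U | tag (g v) == j]|.
Proof.
move=> g_inj; rewrite -(card_imset _ g_inj); apply: eq_card => w.
apply/setIP/imsetP => [[/imsetP[v vU ->]]|[v]].
  by rewrite inE => gv; exists v => //; rewrite inE vU.
by rewrite inE => /andP[vU gv] ->; rewrite imset_f // inE gv.
Qed.

Lemma card_below (n : 'I_d -> nat) (j : 'I_d) (m : nat) : m <= n j ->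
  #|[set v | pos v < m] :&: part n j| = m.
Proof.
move=> le_mn; rewrite -[RHS]card_ord.
rewrite -(@card_imset _ _ (fun x => Tagged (fun i => 'I_(n i)) (widen_ord le_mn x))).
  apply: eq_card => v; rewrite !inE; apply/andP/imsetP => [[ltm /eqP vj]|[x _ ->]].
    by exists (Ordinal ltm) => //; apply: pos_inj.
  by rewrite /pos /= eqxx ltn_ord.
by move=> x y /eqP; rewrite eq_Tagged => /eqP /(congr1 val) /= xy; apply: val_inj.
Qed.

(** Part [i] of the small tensor is listed onto part [sigma^-1 i] of [R]. *)
Lemma box_embedding (n r : 'I_d -> nat) (sigma : 'S_d) (R : {set clique_vertex n})
    (v0 : clique_vertex n) :
  (forall j, #|R :&: part n j| = r (sigma j)) ->
  exists g : clique_vertex r -> clique_vertex n,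
    [/\ injective g, forall x, sigma (tag (g x)) = tag x & g @: setT = R].
Proof.
move=> cardR.
pose R' i := enum (R :&: part n ((sigma^-1)%g i)).
pose g (x : clique_vertex r) := nth v0 (R' (tag x)) (pos x).
have szR i : size (R' i) = r i by rewrite -cardE cardR permKV.
have gR x : g x \in R' (tag x) by rewrite mem_nth // szR; apply: ltn_ord.
have gtag x : sigma (tag (g x)) = tag x.
  by have := gR x; rewrite mem_enum !inE => /andP[_ /eqP ->]; rewrite permKV.
exists g; split => //.
  move=> x y gxy; have xy : tag x = tag y by rewrite -!gtag gxy.
  apply: pos_inj => //; move/eqP: gxy; rewrite /g xy nth_uniq ?enum_uniq ?szR //.
  - by move/eqP.
  - by rewrite -xy; apply: ltn_ord.
  - exact: ltn_ord.
apply/setP => v; apply/imsetP/idP => [[x _ ->]|vR].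
  by have := gR x; rewrite mem_enum => /setIP[].
have vR' : v \in R' (sigma (tag v)) by rewrite mem_enum permK !inE vR eqxx.
have lti : index v (R' (sigma (tag v))) < r (sigma (tag v)) by rewrite -szR index_mem.
exists (Tagged (fun i => 'I_(r i)) (Ordinal lti)) => //.
by rewrite /g /pos /= nth_index.
Qed.

(** Edges have equal sums of [m], having [s] vertices in each part, hence so do [W :\: T] and
    [T :\: W]. Positions in the former lie strictly below [m], in the latter at or above it, and the
    former is nonempty because edges have equal size. *)
Lemma height_lt (n : 'I_d -> nat) (m : 'I_d -> nat) (T W : {set clique_vertex n}) :
  T \in cedges s n -> W \in cedges s n -> W != T ->
  {in T, forall v, m (tag v) <= pos v} ->
  (forall v, v \in W -> v \notin T -> pos v < m (tag v)) ->
  height W < height T.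
Proof.
move=> TE WE nWT Tge Wlt.
have sumE U : U \in cedges s n -> \sum_(v in U) m (tag v) = \sum_(i < d) s * m i.
  move=> /cedgesP UE; rewrite big_parts; apply: eq_bigr => i _.
  rewrite -(UE i) -sum_nat_const; apply: eq_bigr => v.
  by rewrite !inE => /andP[_ /eqP ->].
have := sumE W WE; rewrite -(sumE T TE) (big_setID T) [RHS](big_setID W) /= setIC.
move/addnI => eqm.
rewrite /height (big_setID T) [X in _ < X](big_setID W) /= setIC ltn_add2l.
have [x xW] : exists x, x \in W :\: T.
  apply/set0Pn; apply: contra nWT; rewrite setD_eq0 => sWT.
  by rewrite eqEcard sWT (cedges_card TE) (cedges_card WE) leqnn.
apply: (@leq_trans (\sum_(v in W :\: T) m (tag v))); last first.
  by rewrite eqm; apply: leq_sum => v /setDP[/Tge].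
rewrite (bigD1 x) //= [X in _ < X](bigD1 x) //= -addSn leq_add //.
  by case/setDP: xW => xW /Wlt; apply.
by apply: leq_sum => v /andP[/setDP[vW /Wlt vT] _]; apply/ltnW/vT.
Qed.

(** * The vertex set of a copy is a box *)

Section CopyStructure.
Variables (n r : 'I_d -> nat) (g : clique_vertex r -> clique_vertex n).
Hypotheses (s0 : 0 < s) (sr : forall i, s <= r i) (g_inj : injective g).
Hypothesis gE : forall w, w \in cedges s r -> g @: w \in cedges s n.

Lemma copy_count (w : {set clique_vertex r}) (j : 'I_d) :
  w \in cedges s r -> #|[set v in w | tag (g v) == j]| = s.
Proof. by move=> /gE/cedgesP/(_ j); rewrite card_imset_part. Qed.

(* Exchanging two vertices of a part larger than s turns an edge into an edge,
   so their images cannot lie in different parts. *)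
Lemma copy_big_part (x y : clique_vertex r) :
  s < r (tag x) -> tag y = tag x -> tag (g y) = tag (g x).
Proof.
move=> big yx; have [->//|nyx] := eqVneq y x.
(* An edge through [x] avoiding [y], available because the part has more than [s] vertices. *)
have [||w [wE]] := @cedge_between r [set x] (~: [set y]).
- by rewrite sub1set !inE eq_sym.
- move=> i; apply/andP; split.
    by rewrite (leq_trans _ s0) // -(cards1 x) subset_leq_card // subsetIl.
  rewrite setIC -setDE -(leq_add2l (y \in part r i)) -cardsD1 card_part inE.
  have [<-|_] := eqVneq; last by rewrite add0n.
  by rewrite yx.
rewrite sub1set => xw; rewrite subsetC sub1set inE => yw.
pose w' := y |: (w :\ x).
have w'E : w' \in cedges s r.
  apply/cedgesP => i; have /cedgesP/(_ i) <- := wE.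
  rewrite /w' setIUl.
  rewrite (cardsD1 y) [in RHS](cardsD1 x) !inE eqxx xw yx /=.
  congr (_ + _); first by rewrite (negPf yw) andbF orbF.
  apply: eq_card => v; rewrite !inE.
  have [->|nvy] := eqVneq v y; first by rewrite (negPf yw) !andbF.
  by have [->|nvx] := eqVneq v x; rewrite /= ?andbF.
have := copy_count (tag (g x)) w'E; rewrite -(copy_count (tag (g x)) wE).
rewrite (cardsD1 y) [in RHS](cardsD1 x) !inE !eqxx xw /=.
have -> : [set v in w' | tag (g v) == tag (g x)] :\ y
        = [set v in w | tag (g v) == tag (g x)] :\ x.
  apply/setP => v; rewrite !inE.
  have [->|nvy] := eqVneq v y; first by rewrite (negPf yw) !andbF.
  by have [->|nvx] := eqVneq v x; rewrite /= ?andbF.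
by move/addIn; case: eqP.
Qed.

(** Distinct parts with more than [s] vertices are sent into distinct single parts. Parts with
    exactly [s] lie in every edge; [g] may mix them, but they supply exactly [s] vertices to each
    remaining part. *)
Lemma copy_box :
  (exists sigma : 'S_d, forall j, #|g @: setT :&: part n j| = r (sigma j)) /\
  (forall W, W \in cedges s n -> W \subset g @: setT ->
     exists2 w, w \in cedges s r & W = g @: w).
Proof.
have /fin_all_exists[tau tauP] i :
    exists j, forall x, tag x = i -> s < r i -> tag (g x) = j.
  (* The value of [tau] at a part of size [s] is arbitrary. *)
  have [s_ri|r_le] := ltnP s (r i); last by exists i.
  pose x : clique_vertex r := Tagged (fun i => 'I_(r i)) (Ordinal (leq_trans s0 (sr i))).
  by exists (tag (g x)) => y yi _; apply: copy_big_part; rewrite // yi.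
have small v w : r (tag v) <= s -> w \in cedges s r -> v \in w.
  move=> r_le /cedgesP/(_ (tag v)) wv.
  have /eqP eq_w : w :&: part r (tag v) == part r (tag v).
    by rewrite eqEcard subsetIr card_part wv.
  have : v \in part r (tag v) by rewrite inE.
  by rewrite -eq_w => /setIP[].
(* In an edge [w] through [v], the [s] vertices in part [i] are already all those that [g] sends to
   part [tau i]. *)
have tag_tau i v : s < r i -> tag (g v) = tau i -> tag v = i.
  move=> big gv; have [w wE vw] := cedge_containing v s0 sr.
  have /eqP eq_w : w :&: part r i == [set v in w | tag (g v) == tau i].
    rewrite eqEcard copy_count //; have /cedgesP/(_ i) -> := wE; rewrite leqnn andbT.
    apply/subsetP => x; rewrite !inE => /andP[-> /eqP xi] /=.
    by apply/eqP; apply: tauP.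
  have : v \in [set v in w | tag (g v) == tau i] by rewrite inE vw gv eqxx.
  by rewrite -eq_w !inE => /andP[_ /eqP].
have tagE i v : s < r i -> (tag (g v) == tau i) = (tag v == i).
  by move=> big; apply/eqP/eqP => [/(tag_tau i v big)|/tauP/(_ big)].
pose big := [set i | s < r i].
have tau_inj : {in big &, injective tau}.
  move=> i i'; rewrite !inE => bi bi' tii'.
  pose x : clique_vertex r := Tagged (fun i => 'I_(r i)) (Ordinal (leq_trans s0 (sr i))).
  have : tag x == i' by rewrite -(tagE i' x bi') -tii' (tagE i x bi).
  by move=> /eqP.
have [p pP] := perm_extending tau_inj.
have boxE j : #|g @: setT :&: part n j| = r ((p^-1)%g j).
  rewrite card_imset_part //; set i := (p^-1)%g j.
  have ij : p i = j by rewrite permKV.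
  have [bi|r_le] := ltnP s (r i).
    rewrite -(card_part r i); apply: eq_card => v.
    by rewrite !inE -ij pP ?inE // tagE.
  have -> : r i = s by apply/eqP; rewrite eqn_leq r_le sr.
  pose x : clique_vertex r := Tagged (fun i => 'I_(r i)) (Ordinal (leq_trans s0 (sr i))).
  (* Vertices sent to part [j] come from parts of size [s], since a larger part could only be part
     [i]; so all of them belong to the edge [w], which has [s] vertices sent there. *)
  have [w wE _] := cedge_containing x s0 sr.
  rewrite -(copy_count j wE); apply: eq_card => v; rewrite !inE.
  have [gvj|_] := eqVneq; rewrite ?andbF ?andbT //; apply/esym/small => //.
  rewrite leqNgt; apply/negP => bv; have := tauP (tag v) v erefl bv.
  rewrite gvj -pP ?inE // -ij => /perm_inj iv.
  by move: bv; rewrite -iv ltnNge r_le.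
split; first by exists (p^-1)%g.
move=> W WE sW; pose w := g @^-1: W.
have Ww : W = g @: w.
  apply/setP => v; apply/idP/imsetP => [vW|[x + ->]]; last by rewrite inE.
  by have /imsetP[x _ vx] := subsetP sW v vW; exists x => //; rewrite inE -vx.
exists w => //; apply/cedgesP => i.
have [bi|r_le] := ltnP s (r i).
  have /cedgesP/(_ (tau i)) := WE; rewrite {1}Ww card_imset_part // => <-.
  by apply: eq_card => v; rewrite !inE tagE.
transitivity #|part r i|; last by apply/eqP; rewrite card_part eqn_leq r_le sr.
apply: eq_card => v; rewrite !inE; have [vi|_] := eqVneq; rewrite ?andbF ?andbT //.
have : g v \in g @: setT :&: part n (tag (g v)) by rewrite !inE eqxx imset_f.
(* This part of the box has only [s] vertices, as otherwise [v] would lie in a part with more than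
   [s]; so [W] contains all of it. *)
have /eqP <- : W :&: part n (tag (g v)) == g @: setT :&: part n (tag (g v)).
  rewrite eqEcard setSI // boxE; have /cedgesP/(_ (tag (g v))) -> := WE.
  rewrite leqNgt; apply/negP => bj; have := tagE _ v bj.
  rewrite -pP ?inE // permKV eqxx => /esym/eqP vj.
  by move: bj; rewrite -vj vi ltnNge r_le.
by move=> /setIP[].
Qed.

End CopyStructure.
End Cliques.

(** * The weak saturation number *)

Section Wsat.
Variables (d s : nat) (n r : 'I_d -> nat).
Hypotheses (s0 : 0 < s) (sr : forall i, s <= r i).

Notation V := (clique_vertex n).
Notation Kn := (clique_tensor (fun _ : 'I_d => s) n).
Notation Kr := (clique_tensor (fun _ : 'I_d => s) r).

(** The set Q of the overview, with edges as vertex sets instead of families of slices. *)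
Definition top_edges : {set {set V}} :=
  [set W in cedges s n |
    [exists sigma : 'S_d, [forall v in W, r (sigma (tag v)) - s <= pos v]]].

Lemma wsat_ge (v0 : V) (F : {set {set V}}) :
  @weakly_saturated Kn Kr F -> #|cedges s n :\: top_edges| <= #|F|.
Proof.
case/andP=> sFE /existsP[t /andP[tE /forallP tP]].
have mem_t : t =i cedges s n :\: F by move=> W; rewrite (perm_mem tE) mem_enum.
apply: (@triangular_percolation _ _ (cedges s n) F _ (edge_minor s v0) (@height d n) t).
- exact: subsetDl.
- by move=> W /setDP[WE _]; apply: edge_minor_diag.
- move=> W S /setDP[WE _] /setDP[SE _].
  exact: edge_minor_triangular.
- by move=> W WE WF; rewrite mem_t inE WF.
move=> i; rewrite size_tuple => lti.
have /in_copyP[g [g_inj gE [w0 w0E eg]]] := tP (Ordinal lti).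
have gE' w : w \in cedges s r -> g @: w \in cedges s n.
  move=> /gE /setUP[/(subsetP sFE)//|].
  by rewrite inE => /mem_take; rewrite mem_t => /setDP[].
have [[sigma box] sub] := copy_box s0 sr g_inj gE'.
have [|z [z1 z2 z3]] := @box_relation d s n v0 (g @: setT) s0.
  by move=> j; rewrite box.
exists z; split.
- move=> W Wi; have WE : W = tnth t (Ordinal lti).
    rewrite (tnth_nth W) /= -Wi nth_index // -index_mem Wi size_tuple.
    exact: lti.
  rewrite WE eg; apply: z1; [exact: gE' | exact: imsetS (subsetT _)].
(* The support consists of edges of the copy, which lie in [F] or among the first [i + 1] entries of
   [t]. *)
- move=> W WE /(z2 W WE) /(sub W WE)[w wE ->].
  case/setUP: (gE w wE) => [->//|]; rewrite inE => Wt; apply/orP; right.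
  by rewrite -ltnS index_ltn.
(* Outside [top_edges], [S] fails the condition for the permutation of this copy, and a vertex [u]
   below the threshold is what the relation requires. *)
move=> S /setDP[SE]; rewrite inE SE => /existsPn/(_ sigma).
case/forallPn => u; rewrite negb_imply -ltnNge => /andP[uS ltu].
apply: (z3 S u) => //; rewrite box; lia.
Qed.

Lemma wsat_le (v0 : V) : @weakly_saturated Kn Kr (cedges s n :\: top_edges).
Proof.
apply/andP; split; first exact: subsetDl.
(* Edges are added by increasing height; ties are harmless because the other edges of the copy used
   are strictly lower. *)
set F := cedges s n :\: top_edges; pose leH := relpre (@height d n) leq.
have szt : size (sort leH (enum (cedges s n :\: F))) == #|edges Kn :\: F|.
  by rewrite size_sort -cardE.
apply/existsP; exists (Tuple szt); rewrite /= perm_sort perm_refl /=.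
set t := sort leH _.
have mem_t W : (W \in t) = (W \in top_edges).
  rewrite mem_sort mem_enum !in_setD negb_and negbK.
  by have [/setIdP[-> _]|_] := boolP (W \in top_edges); rewrite /= ?andNb.
have t_uniq : uniq t by rewrite sort_uniq enum_uniq.
have t_sorted : sorted leH t by apply: sort_sorted => A B; apply: leq_total.
apply/forallP => i; set T := tnth _ i.
have ti : T = nth T t i by rewrite {1}/T (tnth_nth T).
have lti : i < size t by rewrite (eqP szt).
have Tt : T \in t by rewrite ti mem_nth.
move: (Tt); rewrite mem_t inE => /andP[TE /existsP[sigma /forall_inP Tge]].
pose m (v : V) := r (sigma (tag v)) - s.
pose R := T :|: [set v | pos v < m v].
have cardR j : #|R :&: part n j| = r (sigma j).
  (* A vertex of [T] in part [j] has position at least [r (sigma j) - s], so the part has that many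
     vertices to add. *)
  have ltm : r (sigma j) - s <= n j.
    have : 0 < #|T :&: part n j| by have /cedgesP -> := TE.
    case/card_gt0P => v /setIP[/Tge mv]; rewrite inE => /eqP <-.
    by apply: leq_trans mv (ltnW (ltn_ord (tagged v))).
  have disj : T :&: part n j :&: ([set v | pos v < m v] :&: part n j) = set0.
    apply/setP => v; rewrite !inE.
    by have [/Tge mv|_] := boolP (v \in T); rewrite //= /m ltnNge mv andbF.
  rewrite setIUl cardsU disj cards0 subn0.
  have /cedgesP -> := TE.
  rewrite -[RHS](subnKC (sr _)) -[in RHS](card_below ltm); congr (_ + _).
  by apply: eq_card => v; rewrite !inE /m; case: eqVneq => [->|]; rewrite ?andbF.
have [g [g_inj gtag gT]] := box_embedding v0 cardR.
have gcount (w : {set clique_vertex r}) j :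
    #|g @: w :&: part n j| = #|w :&: part r (sigma j)|.
  rewrite card_imset_part //; apply: eq_card => v.
  by rewrite !inE -gtag (inj_eq perm_inj).
apply/in_copyP; exists g; split => //.
- move=> w /cedgesP wE; have WE : g @: w \in cedges s n.
    by apply/cedgesP => j; rewrite gcount.
  rewrite in_setU [X in _ || X]inE orbC; have [->|nWT] := eqVneq (g @: w) T.
    by rewrite in_take // {1}ti index_uniq ?ltnSn.
  have ltWT : height (g @: w) < height T.
    apply: (@height_lt _ s n (fun j => r (sigma j) - s)) => // v vW vT.
    have : v \in R by rewrite -gT; apply: (subsetP (imsetS g (subsetT w))).
    by rewrite !inE (negPf vT).
  have [Wtop|nWtop] := boolP (g @: w \in top_edges); last first.
    by rewrite in_setD nWtop WE orbT.
  have Wt : g @: w \in t by rewrite mem_t.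
  rewrite in_take // ltnS leqNgt orbC; apply/orP; right; apply/negP => lti'.
  have := sorted_ltn_nth (fun A B C => @leq_trans _ _ _) T t_sorted.
  move=> /(_ i (index (g @: w) t)) /=; rewrite !inE index_mem => /(_ lti Wt lti').
  by rewrite nth_index // -ti leqNgt ltWT.
have TE' : T = g @: (g @^-1: T).
  apply/setP => v; apply/idP/imsetP => [vT|[x + ->]]; last by rewrite inE.
  have : v \in R by rewrite inE vT.
  by rewrite -gT => /imsetP[x _ vx]; exists x; rewrite ?inE -?vx.
exists (g @^-1: T) => //; apply/cedgesP => j.
have /cedgesP/(_ ((sigma^-1)%g j)) := TE; rewrite {1}TE' gcount permKV.
by [].
Qed.
End Wsat.

(** * Edges as families of slices, and their number *)

Section Slices.
Variables (d s : nat) (n : 'I_d -> nat).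

Definition glue (T : {dffun forall i : 'I_d, {set 'I_(n i)}}) : {set clique_vertex n} :=
  [set v | tagged v \in T (tag v)].

Lemma glue_inj : injective glue.
Proof.
move=> T T' /setP TT'; apply/ffunP => i; apply/setP => j.
by have := TT' (Tagged (fun i => 'I_(n i)) j); rewrite !inE.
Qed.

Lemma glue_onto (W : {set clique_vertex n}) : exists T, W = glue T.
Proof.
exists [ffun i : 'I_d => [set j | Tagged (fun i => 'I_(n i)) j \in W]].
by apply/setP => -[i j]; rewrite !inE ffunE inE.
Qed.

Lemma card_glue_part (T : {dffun forall i : 'I_d, {set 'I_(n i)}}) (i : 'I_d) :
  #|glue T :&: part n i| = #|T i|.
Proof.
rewrite -(@card_imset _ _ (fun j => Tagged (fun i => 'I_(n i)) j)); last first.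
  by move=> x y /eqP; rewrite eq_Tagged => /eqP.
apply: eq_card => v; apply/setIP/imsetP => [[]|[j jT ->]]; rewrite !inE //.
by case: v => i' j jT /eqP /= ii'; case: _ / ii' jT => jT; exists j.
Qed.

Lemma glue_cedges (T : {dffun forall i : 'I_d, {set 'I_(n i)}}) :
  (glue T \in cedges s n) = [forall i, T i \in ksubsets [set: 'I_(n i)] s].
Proof.
apply/cedgesP/forallP => H i; have := H i; rewrite inE subsetT card_glue_part /=.
  by move->.
by move/eqP.
Qed.

Lemma card_cedges : #|cedges s n| = \prod_(i < d) 'C(n i, s).
Proof.
transitivity #|setXn (fun i => ksubsets [set: 'I_(n i)] s)|.
  rewrite -(card_imset _ glue_inj); apply: eq_card => W.
  have [T ->] := glue_onto W; rewrite (mem_imset _ _ glue_inj).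
  by rewrite in_setXn glue_cedges.
rewrite cardsXn; apply: eq_bigr => i _.
by rewrite cards_draws cardsT card_ord.
Qed.

Lemma card_top_edges (r : 'I_d -> nat) : #|top_edges s n r| = qtilde n s r.
Proof.
rewrite /qtilde -(card_imset _ glue_inj); apply: eq_card => W.
have [T ->] := glue_onto W.
rewrite (mem_imset _ _ glue_inj) /top_edges [LHS]in_set [RHS]in_set.
rewrite glue_cedges; apply: andb_id2l => /forallP TE.
apply: eq_existsb => sigma; apply/forall_inP/forallP => H.
  move=> i; have := TE i; rewrite !inE => /andP[_ ->]; rewrite andbT.
  apply/subsetP => j jT; rewrite !inE -leqNgt.
  by apply: (H (Tagged (fun i => 'I_(n i)) j)); rewrite inE.
move=> v; rewrite inE => vT; have := H (tag v); rewrite inE => /andP[/subsetP/(_ _ vT)].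
by rewrite !inE -leqNgt.
Qed.

End Slices.

Theorem theorem1p1 (d s : nat) (n r : 'I_d -> nat)
    (hd : (1 <= d)%N) (hs : (1 <= s)%N)
    (hn : forall i : 'I_d, (s <= n i)%N)
    (hr : forall i : 'I_d, (s <= r i)%N) :
  ((wsat (clique_tensor (fun _ : 'I_d => s) n)
         (clique_tensor (fun _ : 'I_d => s) r))%:Z
   = (\prod_(i < d) 'C(n i, s))%N%:Z - (qtilde n s r)%:Z)%R.
Proof.
(* A default vertex for the enumerations, taken in the first part. *)
pose v0 : clique_vertex n :=
  Tagged (fun i => 'I_(n i)) (Ordinal (leq_trans hs (hn (Ordinal hd)))).
have [[F Fsat Fwsat] minF] := wsatP (clique_tensor (fun _ : 'I_d => s) n)
  (clique_tensor (fun _ : 'I_d => s) r).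
have wsatE : wsat (clique_tensor (fun _ : 'I_d => s) n)
    (clique_tensor (fun _ : 'I_d => s) r) = #|cedges s n :\: top_edges s n r|.
  apply/eqP; rewrite eqn_leq; apply/andP; split; last first.
    by rewrite -Fwsat; apply: wsat_ge.
  by apply: minF; apply: wsat_le.
have sTE : top_edges s n r \subset cedges s n.
  by apply/subsetP => W /setIdP[].
rewrite wsatE cardsDS // -card_cedges -card_top_edges.
by rewrite -subzn ?subset_leq_card.
Qed.
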